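(* Let $\Gamma$ be a countable group, let $\Gamma\curvearrowright X$ be a free action by homeomorphisms on a compact metric space, and let $\Lambda<\Gamma$ be a finite index subgroup, acting on $X$ by restriction. Then $\mathrm{DAD}(\Gamma\curvearrowright X)=\mathrm{DAD}(\Lambda\curvearrowright X)$.
   Context: For an action $\Gamma\curvearrowright X$ by homeomorphisms on a compact Hausdorff space, the dynamic asymptotic dimension $\mathrm{DAD}(\Gamma\curvearrowright X)$ is the smallest integer $d\ge 0$ such that for every finite $F\subset\Gamma$ there is an open cover $\{U_0,\dots,U_d\}$ of $X$ such that for all $0\le j\le d$ the set of $g\in\Gamma$ for which there exist $f_1,\dots,f_k\in F$ and $x\in U_j$ with $g=f_k\cdots f_1$ and $f_{k_0}\cdots f_1\cdot x\in U_j$ for all $1\le k_0\le k$ is finite. It is $\infty$ if no such $d$ exists. *)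

(* Defs.v *)
From HB Require Import structures.
From mathcomp Require Import all_boot all_order all_algebra.
From mathcomp Require Import all_classical all_reals all_analysis.

Set Implicit Arguments.
Unset Strict Implicit.
Unset Printing Implicit Defensive.

Local Open Scope classical_set_scope.
Local Open Scope group_scope.

(* Each [act g] is a homeomorphism: it is continuous and, by [act_one] and
   [act_mul], its inverse is the continuous map [act g^-1]. *)
Record homeo_action (G : groupType) (X : topologicalType) := HomeoAction {
  act :> G -> X -> X;
  act_one : forall x, act 1 x = x;
  act_mul : forall g h x, act (g * h) x = act g (act h x);
  act_continuous : forall g, continuous (act g)
}.

Definition free_action (G : groupType) (X : topologicalType)
    (a : homeo_action G X) : Prop :=
  forall g x, a g x = x -> g = 1.

Definition finite_index (G : groupType) (H : set G) : Prop :=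
  finite_set (range (fun g : G => [set g * h | h in H])).

Section Restriction.
Variables (G : groupType) (S : pred G) (L : subGroupType S).
Variables (X : topologicalType) (a : homeo_action G X).

Let ract (l : L) (x : X) : X := a (val l) x.

Fact ract_one x : ract 1 x = x.
Proof. by rewrite /ract val1 act_one. Qed.

Fact ract_mul g h x : ract (g * h) x = ract g (ract h x).
Proof. by rewrite /ract valM act_mul. Qed.

Fact ract_continuous g : continuous (ract g).
Proof. exact: act_continuous. Qed.

Definition restrict_action : homeo_action L X :=
  HomeoAction ract_one ract_mul ract_continuous.

End Restriction.

Section DynamicAsymptoticDimension.
Variables (G : groupType) (X : topologicalType) (a : homeo_action G X).

(* The product f_k * ... * f_1 of the word [:: f_1; ...; f_k]: letters are
   listed in the order in which they act. *)
Definition word_prod (s : seq G) : G := \prod_(f <- rev s) f.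

Definition reachable (F : set G) (U : set X) : set G :=
  [set g | exists (s : seq G) (x : X),
    [/\ (0 < size s)%N,
        (forall f, f \in s -> F f),
        U x,
        g = word_prod s &
        forall k, (1 <= k <= size s)%N -> U (a (word_prod (take k s)) x)]].

(* The sets U_0, ..., U_d form an indexed family: they may be empty or
   coincide. *)
Definition DAD_at_most (d : nat) : Prop :=
  forall F : set G, finite_set F ->
    exists U : 'I_d.+1 -> set X,
      [/\ forall j, open (U j),
          \bigcup_j U j = [set: X] &
          forall j, finite_set (reachable F (U j))].

(* [Some d] is the finite value d and [None] is the value infinity. *)
Definition DAD : option nat :=
  if pselect (exists d, `[< DAD_at_most d >]) is left ex
  then Some (ex_minn ex) else None.

End DynamicAsymptoticDimension.

(* Main.v *)
Require Import Defs.
From HB Require Import structures.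
From mathcomp Require Import all_boot all_order all_algebra.
From mathcomp Require Import finmap.
From mathcomp Require Import all_classical all_reals all_analysis.
From mathcomp Require Import ring.

Set Implicit Arguments.
Unset Strict Implicit.
Unset Printing Implicit Defensive.

Local Open Scope classical_set_scope.
Local Open Scope group_scope.

(* Only DAD(Gamma) <= DAD(Lambda) needs an argument. Put I = Gamma / Lambda.
   A good cover for Lambda induces d+1 good open families on the Gamma-space
   X * I (pull back along (x, h Lambda) |-> h^-1 x), and these must be pushed
   down to X. A point of X has #|I| sheets above it. Where all the sheets lie in
   a common member of color j, color the point j. Elsewhere, the sheets are
   split by some member of the cover; if the splitting has a gap that no single
   F-step crosses, the sheets on one side form an F-invariant selection of fewer
   sheets, and one concludes by induction on the number of selected sheets.
   Gaps exist because each member of the cover is thickened successively, more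
   often than there are sheets. The number of pieces obtained depends only on d
   and #|I|, so that their colorings can be merged: if the F-walks in U displace
   by K and V is good for the steps F(1|K)F, then U | V is good for F. The
   piece of unsplit points comes last, since its bound depends on the cover,
   which has to be good for all the step sets met before. *)

(** * Product sets, and walks that stay in a set *)

Definition setM (G : groupType) (A B : set G) : set G :=
  [set x * y | x in A & y in B].

Definition setV (G : groupType) (A : set G) : set G := [set x^-1 | x in A].

Lemma finite_setM (G : groupType) (A B : set G) :
  finite_set A -> finite_set B -> finite_set (setM A B).
Proof. exact: finite_image2. Qed.

Section Walks.
Variables (G : groupType) (T : Type) (act : G -> T -> T).
Hypothesis act1 : forall t, act 1 t = t.
Hypothesis actM : forall g h t, act (g * h) t = act g (act h t).

(** An arbitrary type [T] is allowed because walks occur both in X and in X * I. Empty walks are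
    included; compared with [reachable] they add only 1. *)
Inductive walk (F : set G) (U : set T) (t : T) : G -> Prop :=
| walk_nil : U t -> walk F U t 1
| walk_cons f g : walk F U t g -> F f -> U (act (f * g) t) ->
    walk F U t (f * g).

Definition walk_bounded (F : set G) (U : set T) (K : set G) :=
  forall t g, walk F U t g -> K g.

Lemma walk_start F U t g : walk F U t g -> U t.
Proof. by elim. Qed.

Lemma walk_end F U t g : walk F U t g -> U (act g t).
Proof. by case=> // Ut; rewrite act1. Qed.

Lemma walk_sub F F' U t g : F `<=` F' -> walk F U t g -> walk F' U t g.
Proof.
move=> sFF'; elim=> [|f h _ IH Ff Ufh]; first exact: walk_nil.
by apply: walk_cons => //; apply: sFF'.
Qed.

Lemma walk_bounded_sub F F' U K K' :
  F `<=` F' -> K `<=` K' -> walk_bounded F' U K -> walk_bounded F U K'.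
Proof. by move=> sF sK bU t g /(walk_sub sF)/bU/sK. Qed.

(* The steps between two consecutive visits to [V] of an [F]-walk in
   [U `|` V] that spends the time in between inside [U]. *)
Definition detour (F K : set G) := setM (setM F (1 |` K)) F.

Lemma finite_detour F K :
  finite_set F -> finite_set K -> finite_set (detour F K).
Proof.
by move=> fF fK; do !apply: finite_setM => //; rewrite finite_setU; split.
Qed.

(** From right to left: the way to V, the moves along V by detours, the last stay in U. The sole [K]
    is for walks that remain in U. *)
Definition merged (F K K' : set G) :=
  K `|` setM (setM (1 |` K) F) (setM K' (setM F (1 |` K))).

Lemma finite_merged F K K' : finite_set F -> finite_set K ->
  finite_set K' -> finite_set (merged F K K').
Proof.
move=> fF fK fK'; rewrite finite_setU; split=> //.
by do !apply: finite_setM => //; rewrite finite_setU; split.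
Qed.

(** Label the points of the walk by U or V and cut at the first and last label V; a stay in U
    between two labels V is one [detour] step. As [F 1] holds, missing stays count as trivial
    factors. *)
Lemma walk_bounded_setU F U V K K' : F 1 ->
  walk_bounded F U K -> walk_bounded (detour F K) V K' ->
  walk_bounded F (U `|` V) (merged F K K').
Proof.
move=> F1 bU bV t g.
have sF f : F f -> detour F K f.
  move=> Ff; exists f => //; last by exists 1; rewrite ?mulg1.
  by exists f => //; exists 1; rewrite ?mulg1//; left.
pose B := detour F K.
(* Invariant: V not met yet, now at V, or back in U after V. Here [w] leads to V, [v] moves along V
   and [u] along U. *)
pose inU := walk F U t.
pose atV g := exists w v, [/\ setM F (1 |` K) w, walk B V (act w t) v &
  g = v * w].
pose leftV g := exists w v f u, [/\ setM F (1 |` K) w, walk B V (act w t) v,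
  F f, walk F U (act (f * (v * w)) t) u & g = u * f * (v * w)].
move=> W; have: inU g \/ atV g \/ leftV g.
  have atV0 w : setM F (1 |` K) w -> V (act w t) -> atV w.
    by move=> Fw Vw; exists w, 1; rewrite mul1g; split=> //; apply: walk_nil.
  elim: W => [[Ut|Vt]|f h _ IH Ff]; last case: IH
    => [inUh|[[w [v [Fw Wv ->]]]|[w [v [f' [u [Fw Wv Ff' Wu ->]]]]]]].
  - by left; apply: walk_nil.
  - right; left; apply: atV0; last by rewrite act1.
    by exists 1 => //; exists 1; rewrite ?mulg1//; left.
  - case=> [Ufh|Vfh]; first by left; apply: walk_cons.
    right; left; apply: atV0 => //.
    by exists f => //; exists h => //; right; apply: bU inUh.
  - case=> [Uf|Vf]; right; [right|left].
      exists w, v, f, 1; split=> //; rewrite ?mul1g//; first exact: walk_nil.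
    exists w, (f * v); rewrite mulgA; split=> //; apply: walk_cons => //.
      exact: sF.
    by rewrite -actM -mulgA.
  - case=> [Uf|Vf]; right; [right|left].
      exists w, v, f', (f * u); split=> //; last by rewrite !mulgA.
      by apply: walk_cons => //; rewrite -actM !mulgA in Uf *.
    exists w, (f * u * f' * v); split=> //; last by rewrite !mulgA.
    apply: walk_cons => //; last by rewrite -actM !mulgA in Vf *.
    exists (f * u) => //; last by exists f'.
    by exists f => //; exists u => //; right; apply: bU Wu.
case=> [/bU|[[w [v [Fw /bV K'v ->]]]|[w [v [f [u [Fw /bV K'v Ff /bU Ku ->]]]]]]].
- by left.
- right; exists 1; last first.
    by exists (v * w); [exists v => //; exists w|rewrite mul1g].
  by exists 1; [left|exists 1; rewrite ?mulg1].
- right; exists (u * f); last by exists (v * w) => //; exists v => //; exists w.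
  by exists u; [right|exists f].
Qed.

End Walks.

(** * Dynamic asymptotic dimension in terms of walks *)

Section DADWalks.
Variables (G : groupType) (X : topologicalType) (a : homeo_action G X).

Lemma word_prod_rcons (s : seq G) f : word_prod (rcons s f) = f * word_prod s.
Proof. by rewrite /word_prod rev_rcons big_cons. Qed.

Lemma reachable_walk F U g : reachable a F U g -> exists x, walk a F U x g.
Proof.
move=> [s [x [_ Fs Ux -> Us]]]; exists x.
elim/last_ind: s Fs Us => [|s f IH] Fs Us.
  by rewrite /word_prod big_nil; apply: walk_nil.
rewrite word_prod_rcons; apply: walk_cons.
- apply: IH => [h hs|k /andP[k0 ks]].
    by apply: Fs; rewrite mem_rcons inE hs orbT.
  have := Us k; rewrite -cats1 takel_cat//; apply.
  by rewrite k0 size_cat (leq_trans ks)// leq_addr.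
- by apply: Fs; rewrite mem_rcons mem_head.
- have := Us (size s).+1; rewrite size_rcons leqnn => /(_ isT).
  by rewrite -(size_rcons s f) take_size word_prod_rcons.
Qed.

Lemma walk_reachable F U x g :
  walk a F U x g -> (1 |` reachable a F U) g.
Proof.
move=> W; have: exists s : seq G, [/\ (forall f, f \in s -> F f), U x,
    g = word_prod s &
    forall k, (1 <= k <= size s)%N -> U (a (word_prod (take k s)) x)].
  elim: W => [Ux|f h W [s [Fs Ux -> Us]] Ff Uf].
    by exists [::]; split=> // [|[]//]; rewrite /word_prod big_nil.
  exists (rcons s f); split=> //.
  - by move=> f'; rewrite mem_rcons inE => /orP[/eqP ->//|/Fs].
  - by rewrite word_prod_rcons.
  - move=> k /andP[k0]; rewrite size_rcons leq_eqVlt => /orP[/eqP ->|].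
      by rewrite -(size_rcons s f) take_size word_prod_rcons.
    rewrite ltnS => ks; rewrite -cats1 takel_cat//; apply: Us.
    by rewrite k0.
case=> -[|f s] [Fs Ux -> Us]; first by left; rewrite /word_prod big_nil.
by right; exists (f :: s), x; split.
Qed.

Lemma DAD_at_mostP d : DAD_at_most a d <->
  forall F, finite_set F -> exists (U : 'I_d.+1 -> set X) (K : set G),
    [/\ forall j, open (U j), forall x, exists j, U j x, finite_set K &
        forall j, walk_bounded a F (U j) K].
Proof.
split=> [D F fF|D F fF].
  have [U [oU cU fU]] := D F fF.
  exists U, (\bigcup_(j in setT) (1 |` reachable a F (U j))); split=> //.
  - by move=> x; have : setT x by []; rewrite -cU => -[j _ Ujx]; exists j.
  - apply: bigcup_finite => // j _; rewrite finite_setU; split=> //.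
  - by move=> j x g /walk_reachable Kg; exists j.
have [U [K [oU cU fK bU]]] := D F fF.
exists U; split=> //.
  by rewrite -subTset => x _; have [j Ujx] := cU x; exists j.
by move=> j; apply: sub_finite_set fK => g /reachable_walk[x /bU].
Qed.

End DADWalks.

(** * Restriction to a subgroup: the easy inequality *)

Section Restrict.
Variables (G : groupType) (S : pred G) (L : subGroupType S).
Variables (X : topologicalType) (a : homeo_action G X).

Lemma walk_restrict F U x l :
  walk (restrict_action L a) F U x l -> walk a (val @` F) U x (val l).
Proof.
elim=> [Ux|f g _ IH Ff Ufg]; first by rewrite val1; apply: walk_nil.
by rewrite valM; apply: walk_cons => //; [exists f|rewrite -valM].
Qed.

Lemma finite_preimage_val (A : set G) :
  finite_set A -> finite_set [set l : L | A (val l)].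
Proof.
move=> fA; apply: (@finite_preimage _ _ A val) => //.
by move=> x y _ _; apply: val_inj.
Qed.

Lemma DAD_at_most_restrict d :
  DAD_at_most a d -> DAD_at_most (restrict_action L a) d.
Proof.
move=> /DAD_at_mostP D; apply/DAD_at_mostP => F fF.
have [U [K [oU cU fK bU]]] := D _ (finite_image (val : L -> G) fF).
exists U, [set l : L | K (val l)]; split=> //.
  exact: finite_preimage_val.
by move=> j x l /walk_restrict/bU.
Qed.

End Restrict.

(** * Coloring X by induction on the number of sheets *)

Section Sheets.
Variables (G : groupType) (X : topologicalType) (a : homeo_action G X).
Variables (I : finType) (b : G -> I -> I).
Hypothesis b1 : forall i, b 1 i = i.
Hypothesis bM : forall g h i, b (g * h) i = b g (b h i).
Variable d : nat.

Definition colorable (F K : set G) (C : set X) :=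
  exists V : 'I_d.+1 -> set X, [/\ forall j, open (V j),
    forall x, C x -> exists j, V j x & forall j, walk_bounded a F (V j) K].

Lemma colorable_merge F K K' C C' : F 1 ->
  colorable F K C -> colorable (detour F K) K' C' ->
  colorable F (merged F K K') (C `|` C').
Proof.
move=> F1 [V [oV cV bV]] [V' [oV' cV' bV']].
exists (fun j => V j `|` V' j); split=> [j|x [/cV|/cV'] [j Vj]|j].
- exact: openU.
- by exists j; left.
- by exists j; right.
- by apply: walk_bounded_setU => //; [exact: act_one|exact: act_mul].
Qed.

Lemma colorable_sub F F' K C C' : F `<=` F' -> C `<=` C' ->
  colorable F' K C' -> colorable F K C.
Proof.
move=> sF sC [V [oV cV bV]]; exists V; split=> // [x /sC/cV//|j].
exact: walk_bounded_sub (bV j).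
Qed.

(* [A x] selects sheets of [X * I] over [x], consistently along [F]-steps
   that stay in [C]. *)
Definition sheets (F : set G) (k : nat) (C : set X) (A : X -> {set I}) :=
  [/\ forall x, C x -> (0 < #|A x| <= k)%N,
      forall x, C x -> \forall y \near x, C y /\ A y = A x &
      forall f x i, F f -> C x -> C (a f x) -> i \in A x ->
        b f i \in A (a f x)].

(** [F'] and [K] precede [C] and [A]: the bound is uniform over all pieces, so the ladder that
    produces them may be chosen afterwards. *)
Definition sheets_colorable (k : nat) := forall F : set G,
  finite_set F -> F 1 -> exists F' K : set G,
    [/\ finite_set F', F `<=` F', finite_set K &
    forall C A, sheets F' k C A -> colorable F K C].

Lemma sheets_sub F F' k C A : F `<=` F' -> sheets F' k C A -> sheets F k C A.
Proof. by move=> sF [A0 An AF]; split=> // f x i /sF; apply: AF. Qed.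

(** One piece is colored for [F], the remaining ones for the enlarged step set [detour F K1]. Only
    the number of pieces is fixed beforehand. *)
Lemma sheets_colorable_bigcup k n F : sheets_colorable k ->
  finite_set F -> F 1 -> exists F' K : set G,
    [/\ finite_set F', F `<=` F', finite_set K &
    forall C : nat -> set X,
      (forall i, (i < n)%N -> exists A, sheets F' k (C i) A) ->
      colorable F K [set x | exists2 i, (i < n)%N & C i x]].
Proof.
move=> Qk; elim: n F => [|n IH] F fF F1.
  exists F, set0; split=> // C _; exists (fun=> set0); split=> [j|x [[]]//|j].
    exact: open0.
  by move=> x g W; case: (walk_start W).
have [F1' [K1 [fF1 sF1 fK1 col1]]] := Qk F fF F1.
have F1B : detour F K1 1.
  exists 1; last by exists 1; rewrite ?mulg1.
  by exists 1 => //; exists 1; rewrite ?mulg1//; left.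
have [F2 [K2 [fF2 sF2 fK2 col2]]] := IH _ (finite_detour fF fK1) F1B.
exists (F1' `|` F2), (merged F K1 K2); split=> //.
- by rewrite finite_setU.
- by move=> f Ff; left; apply: sF1.
- exact: finite_merged.
move=> C sC; have [A sA] := sC n (leqnn _).
have c1 := col1 _ _ (sheets_sub (@subsetUl _ _ _) sA).
have c2 : colorable (detour F K1) K2 [set x | exists2 i, (i < n)%N & C i x].
  apply: col2 => i ni; have [A' sA'] := sC i (ltnW ni).
  by exists A'; apply: sheets_sub sA'; apply: subsetUr.
apply: colorable_sub (colorable_merge F1 c1 c2) => // x [i].
by rewrite ltnS leq_eqVlt => /orP[/eqP ->|ni Cx]; [left|right; exists i].
Qed.

Definition sheet_act (g : G) (t : X * I) := (a g t.1, b g t.2).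

(** For each color, open sets [O] and closed sets [E] alternate in an increasing chain, and [E j s]
    absorbs one step from [O j s]. The topological conditions are imposed sheet by sheet, on X
    alone. *)
Record ladder (F K : set G) (M : nat) (O E : 'I_d.+1 -> nat -> set (X * I)) :=
{ ladder_open : forall j s x i, O j s (x, i) -> \forall y \near x, O j s (y, i);
  ladder_closed : forall j s x i, ~ E j s (x, i) ->
    \forall y \near x, ~ E j s (y, i);
  ladder_cover : forall t, exists j, O j 0 t;
  ladder_sub : forall j s, O j s `<=` E j s;
  ladder_step : forall j s f t, F f -> O j s t -> E j s (sheet_act f t);
  ladder_succ : forall j s, E j s `<=` O j s.+1;
  ladder_bounded : forall j, walk_bounded sheet_act F (O j M) K }.

Section Step.
Variables (F K : set G) (M : nat) (O E : 'I_d.+1 -> nat -> set (X * I)).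
Hypothesis lad : ladder F K M O E.
Variables (k : nat) (C : set X) (A : X -> {set I}).
Hypothesis sheetsA : sheets F k C A.

Definition low j s x := [set i in A x | `[< O j s (x, i) >]].

Definition high j s x := [set i in A x | `[< ~ E j s (x, i) >]].

(** No selected sheet lies in the layer between [O] and [E], and both sides are occupied: this is
    the gap that no step of [F] crosses. *)
Definition split_piece j s : set X := [set x | [/\ C x, low j s x != finset.set0,
  high j s x != finset.set0 & A x = low j s x :|: high j s x]].

Lemma select_near (P : set (X * I)) x :
  (forall i, P (x, i) -> \forall y \near x, P (y, i)) -> C x ->
  \forall y \near x, [set i in A x | `[< P (x, i) >]]%SET
    \subset [set i in A y | `[< P (y, i) >]]%SET.
Proof.
have [_ An _] := sheetsA; move=> oP Cx.
have Pnear i : \forall y \near x, P (x, i) -> P (y, i).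
  have [/oP H|nP] := pselect (P (x, i)); first by apply: filterS H.
  by near=> y.
apply: filterS2 (An _ Cx) (filter_forall _ Pnear) => y [_ Ayx] Py.
apply/fintype.subsetP => i; rewrite !inE Ayx => /andP[-> /asboolP Pi].
exact/asboolP/Py.
Unshelve. all: by end_near. Qed.

Lemma low_high j s x : low j s x :&: high j s x = finset.set0.
Proof.
apply/setP => i; rewrite !inE.
apply/negP => /andP[/andP[_ /asboolP Oi] /andP[_ /asboolP]]; apply.
exact: (ladder_sub lad).
Qed.

(** As [high] is nonempty, [low] has lost a sheet. A step from [O] lands in [E], hence outside
    [high], so it stays in [low]. *)
Lemma split_piece_sheets k' j s : (k <= k'.+1)%N ->
  sheets F k' (split_piece j s) (low j s).
Proof.
have [A0 An AF] := sheetsA => kk'; split.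
- move=> x [Cx l0 h0 Ax]; rewrite card_gt0 l0/=.
  have /andP[_ Ak] := A0 _ Cx; rewrite -ltnS.
  apply: (leq_trans _ kk'); apply: leq_trans Ak.
  rewrite Ax cardsU low_high cards0 subn0.
  by rewrite -addn1 leq_add2l card_gt0.
- move=> x [Cx l0 h0 Ax].
  near=> y.
  have ll : low j s x \subset low j s y.
    by near: y; apply: select_near => // i; apply: (ladder_open lad).
  have hh : high j s x \subset high j s y.
    near: y; apply: (select_near (P := ~` E j s)) => // i.
    exact: (ladder_closed lad).
  have [Cy Ay] : C y /\ A y = A x by near: y; exact: An.
  (* Near x, [low] and [high] can only grow; they are disjoint and already exhaust [A x], so [low]
     is constant. *)
  have lE : low j s y = low j s x.
    apply/eqP; rewrite finset.eqEsubset ll andbT; apply/fintype.subsetP => i il.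
    have : i \in A x by rewrite -Ay; move: il; rewrite inE => /andP[].
    rewrite Ax inE => /orP[//|/(fintype.subsetP hh) ih].
    by have /setP/(_ i) := low_high j s y; rewrite finset.inE il ih finset.inE.
  split=> //; split=> //.
  + by rewrite lE.
  + by apply: contra_neq h0 => h0; move: hh; rewrite h0 finset.subset0 => /eqP.
  + apply/eqP; rewrite finset.eqEsubset; apply/andP; split.
      by rewrite Ay Ax finset.setUSS.
    by apply/fintype.subsetP => i; rewrite !inE => /orP[] /andP[].
- move=> f x i Ff [Cx _ _ Ax] [Cfx _ _ Afx].
  rewrite inE => /andP[Ai /asboolP/(ladder_step lad Ff) Efi].
  have := AF _ _ _ Ff Cx Cfx Ai; rewrite Afx inE => /orP[//|].
  by rewrite inE => /andP[_ /asboolP].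
Unshelve. all: by end_near. Qed.

Definition unsplit j : set X :=
  [set x | C x /\ forall i, i \in A x -> O j M (x, i)].

Lemma unsplit_open j : open (unsplit j).
Proof.
have [A0 An AF] := sheetsA.
rewrite openE => x [Cx Ox]; rewrite /interior.
have Onear i : \forall y \near x, i \in A x -> O j M (y, i).
  have [/Ox/(ladder_open lad) H|/negP il] := boolP (i \in A x).
    by apply: filterS H.
  by near=> y.
apply: filterS2 (An _ Cx) (filter_forall _ Onear) => y [Cy Ayx] Oy.
split=> // i; rewrite Ayx; apply: Oy.
Unshelve. all: by end_near. Qed.

(** The walk lifts to the sheet of some i in [A x] with the same group element; equivariance of [A]
    keeps the lift in [O j M], where [ladder_bounded] applies. *)
Lemma unsplit_bounded j : walk_bounded a F (unsplit j) K.
Proof.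
have [A0 An AF] := sheetsA.
move=> x g W; have [Cx Ox] := walk_start W.
have /andP[/card_gt0P[i Ai] _] := A0 x Cx.
apply: (ladder_bounded lad (j := j) (t := (x, i))).
suff [] : walk sheet_act F (O j M) (x, i) g /\ b g i \in A (a g x) by [].
elim: W => [|f h W [IH Ah] Ff [Cfh Ofh]].
  by rewrite b1 act_one; split=> //; apply: walk_nil; apply: Ox.
have Afh : b (f * h) i \in A (a (f * h) x).
  rewrite bM act_mul; apply: AF => //; rewrite -?act_mul//.
  by case: (walk_end (@act_one _ _ a) W).
by split=> //; apply: walk_cons => //; apply: Ofh.
Qed.

Lemma ladder_le j s s' : (s <= s')%N -> O j s `<=` O j s'.
Proof.
move=> /subnK <-; elim: (s' - s)%N => // n IH x /IH/(ladder_sub lad).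
exact: (ladder_succ lad).
Qed.

(* The layers [E j s `\` O j s] are disjoint for distinct [s], hence fewer than
   [M] sheets leave one of the first [M] layers empty. *)
Lemma unsplit_or_split x : (k < M)%N -> C x ->
  exists j, unsplit j x \/ exists2 s, (s < M)%N & split_piece j s x.
Proof.
have [A0 An AF] := sheetsA; move=> kM Cx.
have /andP[/card_gt0P[i0 Ai0] Ak] := A0 x Cx.
have [j Oj0] := ladder_cover lad (x, i0); exists j.
have [|nO] := pselect (forall i, i \in A x -> O j M (x, i)); first by left.
right; apply: contrapT => nsplit.
have [i1 Ai1 nOi1] : exists2 i, i \in A x & ~ O j M (x, i).
  apply: contrapT => H; apply: nO => i Ai; apply: contrapT => nOi.
  by apply: H; exists i.
(* Were layer s free of selected sheets, i0 would lie below it and i1 above it, and x would be split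
   at level s. *)
have bad (s : 'I_M) : exists i, i \in A x /\ E j s (x, i) /\ ~ O j s (x, i).
  apply: contrapT => H; apply: nsplit; exists s => //; split=> //.
  - apply/set0Pn; exists i0; rewrite inE Ai0; apply/asboolP.
    exact: ladder_le Oj0.
  - apply/set0Pn; exists i1; rewrite inE Ai1; apply/asboolP.
    by move=> /(ladder_succ lad) /(ladder_le (ltn_ord s)).
  - apply/setP => i; rewrite !inE -andb_orr; have [Ai|//] := boolP (i \in A x).
    symmetry; apply/orP; have [Oi|nOi] := pselect (O j s (x, i)).
      by left; apply/asboolP.
    right; apply/asboolP => Ei; apply: H; exists i; split=> //.
have [h hP] := choice bad.
have h_inj : injective h.
  have lt_neq (s s' : 'I_M) : (s < s')%N -> h s <> h s'.
    move=> ss' hE; have [_ [Es _]] := hP s; have [_ [_]] := hP s'; apply.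
    by rewrite -hE; apply: (ladder_le ss'); apply: (ladder_succ lad).
  move=> s s' hE; apply: val_inj; case: (ltngtP s s') => // /lt_neq.
    by move=> /(_ hE).
  by move=> /(_ (esym hE)).
have : (M <= #|A x|)%N.
  rewrite -[M in (M <= _)%N]card_ord -(card_codom h_inj).
  apply: subset_leq_card; apply/fintype.subsetP => _ /codomP[s ->].
  by case: (hP s).
by rewrite leqNgt (leq_ltn_trans Ak).
Qed.

End Step.

Hypothesis ladderP : forall F M, finite_set F -> F 1 ->
  exists K O E, finite_set K /\ ladder F K M O E.

Lemma sheets_colorableP k : sheets_colorable k.
Proof.
elim: k => [|k IH] F fF F1.
  exists F, set0; split=> // C A [A0 _ _].
  exists (fun=> set0); split=> [j|x /A0|j]; first exact: open0.
    by rewrite leqn0 lt0n => /andP[/negPf ->].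
  by move=> x g W; case: (walk_start W).
(* More layers than the k + 1 sheets. There are (d + 1) * M split pieces whatever the ladder, so
   their bound [K] comes first and enters the step set [H] of the ladder. *)
pose M := k.+2.
have [F' [K [fF' sFF' fK col]]] :=
  sheets_colorable_bigcup (d.+1 * M) IH fF F1.
pose H := F' `|` detour F K.
have fH : finite_set H by rewrite finite_setU; split=> //; apply: finite_detour.
have H1 : H 1 by left; apply: sFF'.
have [K' [ O [E [fK' lad]]]] := ladderP M fH H1.
exists H, (merged F K K'); split=> //; first by move=> f Ff; left; apply: sFF'.
  exact: finite_merged.
move=> C A sA.
(* The index n = j * M + s encodes color j and level s. *)
pose piece n := split_piece O E C A (inord (n %/ M)) (n %% M).
have c1 : colorable F K [set x | exists2 n, (n < d.+1 * M)%N & piece n x].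
  apply: col => n _; exists (low O A (inord (n %/ M)) (n %% M)).
  apply: sheets_sub (split_piece_sheets lad sA _ _ _) => //.
  exact: subsetUl.
have c2 : colorable (detour F K) K' [set x | exists j, unsplit M O C A j x].
  exists (unsplit M O C A); split=> [j|x|j] //.
    exact: (unsplit_open lad sA).
  apply: (walk_bounded_sub _ _ (unsplit_bounded lad sA (j := j))) => //.
  exact: subsetUr.
apply: colorable_sub (colorable_merge F1 c1 c2) => // x Cx.
have [j [Wj|[s sM Ps]]] := unsplit_or_split lad sA (ltnSn _) Cx.
  by right; exists j.
left; exists (j * M + s)%N.
  by rewrite (@leq_trans (j.+1 * M))%N// ?leq_mul2r ?ltn_ord ?orbT//
    mulSnr ltn_add2l.
rewrite /piece divnMDl// divn_small// addn0 modnMDl modn_small//.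
by rewrite inord_val.
Qed.

Lemma DAD_at_most_sheets (i0 : I) : DAD_at_most a d.
Proof.
apply/DAD_at_mostP => F fF.
have fF1 : finite_set (1 |` F) by rewrite finite_setU.
have [F' [K [_ sF' fK col]]] :=
  @sheets_colorableP #|I| _ fF1 (@subsetUl _ _ _ _ erefl).
have [|V [oV cV bV]] := col setT (fun=> [set: I]%SET).
  split=> [x _|x _|f x i _ _ _ _]; rewrite ?inE// ?cardsT.
    by rewrite leqnn andbT; apply/card_gt0P; exists i0.
  by near=> y.
exists V, K; split=> // [x|j]; first exact: cV.
by apply: (walk_bounded_sub _ _ (bV j)).
Unshelve. all: by end_near. Qed.

End Sheets.

(** * Lebesgue numbers and nested shrinkings of a cover *)

Section Lebesgue.
Import Order.TTheory GRing.Theory Num.Theory.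
Local Open Scope ring_scope.
Variables (R : realType) (X : pseudoMetricType R) (J : Type).

Lemma lebesgue_number (U : J -> set X) : compact [set: X] ->
  (forall j, open (U j)) -> (forall x, exists j, U j x) ->
  exists2 e : R, 0 < e & forall x, exists j, ball x e `<=` U j.
Proof.
move=> /compact_near_coveringP cX oU cU.
have /cX : forall x : X, [set: X] x -> \forall x' \near x & e \near 0^'+,
    exists j, ball x' e `<=` U j.
  move=> x _; have [j Ujx] := cU x.
  have /nbhs_ballP[r /= r0 xrU] : nbhs x (U j) by apply: open_nbhs_nbhs.
  exists (ball x (r / 2), [set e | e < r / 2]) => /=.
    split; first by apply: nbhsx_ballx; rewrite divr_gt0.
    by apply: nbhs_right_lt; rewrite divr_gt0.
  move=> [x' e] /= [xx' er]; exists j => y x'y; apply: xrU.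
  by rewrite [r]splitr; apply: ball_triangle xx' (le_ball (ltW er) x'y).
move=> H; near (0 : R)^'+ => e; exists e => // x.
have He : [set: X] `<=` [set x' | exists j, ball x' e `<=` U j] by near: e.
exact: He.
Unshelve. all: by end_near. Qed.

Definition erode (U : set X) (e : R) := [set x | ball x e `<=` U].

(** The radius e is spent in thirds: from the eroded set to x, from x to a neighbor z, and within
    the ball around z. *)
Lemma closure_erode U e : 0 < e ->
  closure (erode U e) `<=` interior (erode U (e / 3)).
Proof.
move=> e0 x clx; have e3 : 0 < e / 3 by rewrite divr_gt0.
apply/nbhs_ballP; exists (e / 3) => //= z xz w zw.
have [y [yU xy]] := clx _ (nbhsx_ballx x _ e3).
apply: yU; have -> : e = (e / 3 + e / 3) + e / 3 by field.
exact: ball_triangle (ball_triangle (ball_sym xy) xz) zw.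
Qed.

Lemma compact_shrinkings (U : J -> set X) : compact [set: X] ->
  (forall j, open (U j)) -> (forall x, exists j, U j x) ->
  exists N : J -> nat -> set X, [/\ forall j s, open (N j s),
    forall x, exists j, N j 0%N x,
    forall j s, closure (N j s) `<=` N j s.+1 & forall j s, N j s `<=` U j].
Proof.
move=> cX oU cU; have [e e0 eU] := lebesgue_number cX oU cU.
have r0 s : 0 < e / 3 ^+ s by rewrite divr_gt0// exprn_gt0.
have rS s : e / 3 ^+ s / 3 = e / 3 ^+ s.+1 by rewrite exprSr invfM mulrA.
(* Decreasing radii give increasing sets inside [U j]. The exponent starts at 1 so that level 0
   contains all points whose e-ball lies in [U j]. *)
exists (fun j s => interior (erode (U j) (e / 3 ^+ s.+1))); split.
- by move=> j s; apply: open_interior.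
- move=> x; have [j xU] := eU x; exists j; rewrite -rS.
  apply: closure_erode => //; apply: subset_closure.
  by rewrite /erode/= expr0 divr1.
- move=> j s x clx; rewrite -rS; apply: closure_erode => //.
  by apply: closureS clx; apply: interior_subset.
- by move=> j s x /interior_subset; apply; apply: ballxx.
Qed.

End Lebesgue.

(** * The ladder induced from a cover for Lambda *)

Section InducedLadder.
Variables (R : realType) (X : metricType R) (G : groupType).
Variables (a : homeo_action G X) (S : pred G) (L : subGroupType S).
Variables (I : finType) (b : G -> I -> I) (i0 : I).
Hypothesis b1 : forall i, b 1 i = i.
Hypothesis bM : forall g h i, b (g * h) i = b g (b h i).
Hypothesis b_stab : forall g, b g i0 = i0 -> S g.
Hypothesis b_trans : forall i, exists g, b g i0 = i.

Let bV g i : b g^-1 (b g i) = i. Proof. by rewrite -bM mulVg b1. Qed.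

Let aV g x : a g^-1 (a g x) = x. Proof. by rewrite -act_mul mulVg act_one. Qed.

(* A point [(x, h * i0)] of [X * I] corresponds to the point [h^-1 * x] of [X],
   which is defined up to the action of the stabiliser of [i0]. *)
Definition pullback (H : set G) (N : set X) : set (X * I) :=
  [set t | exists2 h, H h & b h i0 = t.2 /\ N (a h^-1 t.1)].

(** Representatives allowed at level s. A step f replaces h by f h and leaves the point h^-1 x
    unchanged, so one product by [F] per level suffices. *)
Fixpoint spread (F T : set G) (s : nat) : set G :=
  if s is s'.+1 then setM F (spread F T s') else T.

Lemma finite_spread F T s :
  finite_set F -> finite_set T -> finite_set (spread F T s).
Proof. by move=> fF fT; elim: s => //= s; apply: finite_setM. Qed.

Lemma pullback_open H N x i : open N -> pullback H N (x, i) ->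
  \forall y \near x, pullback H N (y, i).
Proof.
move=> oN [h Hh [/= hi Nx]].
have : nbhs x (a h^-1 @^-1` N).
  by apply: (@act_continuous _ _ a h^-1); apply: open_nbhs_nbhs.
by apply: filterS => y Ny; exists h.
Qed.

Lemma pullback_closed H N x i : finite_set H -> closed N ->
  ~ pullback H N (x, i) -> \forall y \near x, ~ pullback H N (y, i).
Proof.
move=> fH cN nP.
have clP : closed (\bigcup_(h in H `&` [set h | b h i0 = i])
    a h^-1 @^-1` N).
  apply: closed_bigcup => [|h _]; first exact: finite_setIl.
  by apply: closed_comp => // y _; apply: act_continuous.
have : nbhs x (~` \bigcup_(h in H `&` [set h | b h i0 = i]) a h^-1 @^-1` N).
  apply: open_nbhs_nbhs; split; first exact: closed_openC.
  by move=> [h [Hh hi] Nx]; apply: nP; exists h.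
by apply: filterS => y + [h Hh [/= hi Ny]]; apply; exists h.
Qed.

(** Through representatives, a step f becomes h2^-1 f h', which fixes [i0] and so lies in Lambda;
    the products telescope to h' l h^-1. *)
Lemma pullback_bounded (F H : set G) (U : set X) (K : set L) :
  walk_bounded (restrict_action L a)
    [set l | setM (setM (setV H) F) H (val l)] U K ->
  walk_bounded (sheet_act a b) F (pullback H U)
    (setM (setM H (val @` K)) (setV H)).
Proof.
move=> bU [x i] g W; have [h Hh [/= hi Ux]] := walk_start W.
suff [h' [l [Hh' h'i Wl ->]]] : exists h' l, [/\ H h', b h' i0 = b g i,
    walk (restrict_action L a) [set l | setM (setM (setV H) F) H (val l)] U
      (a h^-1 x) l & g = h' * val l * h^-1].
  exists (h' * val l); last by exists h^-1 => //; exists h.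
  by exists h' => //; exists (val l) => //; exists l => //; apply: bU Wl.
elim: W => [_|f k _ [h' [l [Hh' h'i Wl kE]]] Ff [h2 Hh2 [/= h2i Ux2]]].
  exists h, 1; rewrite b1 val1 mulg1 mulgV; split=> //; exact: walk_nil.
have Sm : S (h2^-1 * f * h').
  by apply: b_stab; rewrite !bM h'i -(bM f k) -h2i bV.
pose m : L := Sub _ Sm; have mE : val m = h2^-1 * f * h' by rewrite SubK.
exists h2, (m * l); split=> //.
  apply: walk_cons => //=.
    rewrite mE; exists (h2^-1 * f) => //; last by exists h'.
    by exists h2^-1; [exists h2|exists f].
  rewrite valM mE -act_mul; suff -> : h2^-1 * f * h' * val l * h^-1 =
    h2^-1 * (f * k) by rewrite act_mul.
  by rewrite kE !mulgA.
by rewrite valM mE kE !mulgA mulgV mul1g.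
Qed.

Lemma induced_ladder d : compact [set: X] ->
  DAD_at_most (restrict_action L a) d ->
  forall F M, finite_set F -> F 1 ->
  exists K O E, finite_set K /\ ladder a b (d := d) F K M O E.
Proof.
move=> cX /DAD_at_mostP D F M fF F1.
have [h hE] := choice b_trans.
pose T := spread F (range h).
have fT s : finite_set (T s).
  by apply: finite_spread => //; apply: finite_image.
(* The step set for Lambda depends only on [F] and [M]; the cover is chosen for it and shrunk
   afterwards. *)
have fH : finite_set [set l : L | setM (setM (setV (T M)) F) (T M) (val l)].
  apply: finite_preimage_val.
  by do 2!apply: finite_setM => //; apply: finite_image.
have [U [K [oU cU fK bU]]] := D _ fH.
have [N [oN cN NS NU]] := compact_shrinkings cX oU cU.
exists (setM (setM (T M) (val @` K)) (setV (T M))).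
exists (fun j s => pullback (T s) (N j s)).
exists (fun j s => pullback (T s.+1) (closure (N j s))).
split; first by do 2?apply: finite_setM => //; apply: finite_image.
split.
- by move=> j s x i; apply: pullback_open.
- by move=> j s x i; apply: pullback_closed => //; apply: closed_closure.
- move=> [x i]; have [j Nx] := cN (a (h i)^-1 x).
  by exists j, (h i) => //; exists i.
(* As 1 is in [F], [T s] is contained in [T s.+1]. *)
- move=> j s [x i] [g Tg [gi Nx]]; exists g; last first.
    by split=> //; apply: subset_closure.
  by exists 1 => //; exists g; rewrite ?mul1g.
- move=> j s f [x i] Ff [g Tg [/= gi Nx]]; exists (f * g).
    by exists f => //; exists g.
  split; first by rewrite bM gi.
  by apply: subset_closure; rewrite /= invgM act_mul aV.
- by move=> j s [x i] [g Tg [gi Nx]]; exists g => //; split=> //; apply: NS.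
- move=> j; apply: pullback_bounded.
  move=> x l W; apply: (bU j x l).
  elim: W => [Nx|f k _ IH Ff Nx]; [apply: walk_nil|apply: walk_cons => //];
    exact: NU Nx.
Qed.

End InducedLadder.

(** * The action on left cosets, and the conclusion *)

Lemma finite_index_action (G : groupType) (S : pred G) (L : subGroupType S) :
  finite_index [set` S] ->
  exists (I : finType) (b : G -> I -> I) (i0 : I),
    [/\ forall i, b 1 i = i, forall g h i, b (g * h) i = b g (b h i),
    forall g, b g i0 = i0 -> S g & forall i, exists g, b g i0 = i].
Proof.
rewrite /finite_index; set coset := fun g : G => [set g * h | h in [set` S]].
move=> /finite_fsetP[I IE].
have cosetI g : coset g \in I.
  by have : range coset (coset g) by []; rewrite IE.
have Icoset (i : I) : exists g, coset g = val i.
  have : range coset (val i) by rewrite IE /= (valP i).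
  by case=> g _; exists g.
have mulcoset g h : [set g * x | x in coset h] = coset (g * h).
  apply/seteqP; split=> [_ [_ [s Ss <-] <-]|_ [s Ss <-]].
    by exists s; rewrite ?mulgA.
  by exists (h * s); rewrite ?mulgA//; exists s.
(* The default value of [insubd] is never taken, since a translate of a coset is a coset. *)
pose b g (i : I) : I := insubd i [set g * x | x in val i].
have bE g (i : I) : val (b g i) = [set g * x | x in val i].
  by rewrite insubdK//; have [h <-] := Icoset i; rewrite mulcoset.
have S1 : S 1 by have := valP (1 : L); rewrite val1.
exists I, b, [` cosetI 1]%fset; split.
- move=> i; apply: val_inj; rewrite bE.
  by have [h <-] := Icoset i; rewrite mulcoset mul1g.
- move=> g h i; apply: val_inj; rewrite !bE.
  by have [k <-] := Icoset i; rewrite !mulcoset mulgA.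
- move=> g /(congr1 val); rewrite bE /= mulcoset mulg1 => gE.
  have : coset g g by exists 1; rewrite ?mulg1.
  by rewrite gE => -[s Ss <-]; rewrite mul1g.
- move=> i; have [g gE] := Icoset i; exists g; apply: val_inj.
  by rewrite bE /= mulcoset mulg1.
Qed.

Theorem theorem2 (R : realType) (X : metricType R) (G : groupType)
    (a : homeo_action G X) (S : pred G) (L : subGroupType S) :
  compact [set: X] ->
  countable [set: G] ->
  free_action a ->
  finite_index [set` S] ->
  DAD a = DAD (restrict_action L a).
Proof.
move=> cX _ _ /(finite_index_action L)[I [b [i0 [b1 bM bS bT]]]].
suff DE : DAD_at_most a = DAD_at_most (restrict_action L a) by rewrite /DAD DE.
apply/funext => d; apply/propext; split; first exact: DAD_at_most_restrict.
move=> D; apply: (DAD_at_most_sheets b1 bM _ i0) => F M.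
exact: (induced_ladder b1 bM bS bT cX D).
Qed.
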